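(* Let $(\mathfrak a,\mathscr B_{\mathfrak a},\omega_{\mathfrak a})$ be an even NIS-Lie superalgebra over a field $\mathbb K$ of characteristic $2$ equipped with a closed $\bar 1$-antisymmetric ortho-orthogonal form $\omega_{\mathfrak a}$, and let $\tilde\Delta\in\mathfrak{der}(\mathfrak a)_{\bar 0}$ be the unique invertible derivation such that $\omega_{\mathfrak a}(\cdot,\cdot)=\mathscr B_{\mathfrak a}(\tilde\Delta(\cdot),\cdot)$. Let $(\mathfrak g,\mathscr B_{\mathfrak g})$, $\mathfrak g=\mathbb Kx\oplus\mathfrak a\oplus\mathbb Kx^*$, be the $\mathscr D_{\bar 0}$-extension of $(\mathfrak a,\mathscr B_{\mathfrak a})$ by means of a derivation $\mathscr D\in\mathfrak{der}(\mathfrak a)_{\bar 0}$ and a quadratic form $\alpha$ on $\mathfrak a_{\bar 1}$, with $\mathscr B_{\mathfrak g}(x^*,x^* )=0$. Suppose there exist $\lambda\in\mathbb K\setminus\{0\}$ and $a_0\in\mathfrak a_{\bar 0}$ such that $$[\tilde\Delta,\mathscr D]=\lambda\mathscr D+\mathrm{ad}_{a_0},\qquad \lambda\alpha(a)+\mathscr B_{\mathfrak a}(\mathscr D\circ\tilde\Delta(a),a)=\mathscr B_{\mathfrak a}(s_{\mathfrak a}(a),a_0)\ \text{ for all }a\in\mathfrak a_{\bar 1}.$$ Then the linear map $\Delta:\mathfrak g\to\mathfrak g$ defined by $$\Delta(x)=\lambda x,\qquad \Delta(x^* )=\lambda x^*+a_0,\qquad \Delta(a)=\tilde\Delta(a)+\mathscr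 B_{\mathfrak a}(a,a_0)x\quad(a\in\mathfrak a)$$ is an invertible derivation of $\mathfrak g$ for which $\mathscr B_{\mathfrak g}$ is $\Delta$-invariant. Consequently, $(\mathfrak g,\mathscr B_{\mathfrak g},\omega_{\mathfrak g})$ is a NIS-Lie superalgebra with a closed $\bar 1$-antisymmetric ortho-orthogonal form $\omega_{\mathfrak g}:=\mathscr B_{\mathfrak g}(\Delta(\cdot),\cdot)$.
   Context: All spaces are finite-dimensional. A Lie superalgebra in characteristic $2$ is a superspace $\mathfrak g=\mathfrak g_{\bar 0}\oplus\mathfrak g_{\bar 1}$ such that $\mathfrak g_{\bar 0}$ is a Lie algebra, $\mathfrak g_{\bar 1}$ is a $\mathfrak g_{\bar 0}$-module made two-sided by symmetry, together with a squaring $s_{\mathfrak g}:\mathfrak g_{\bar 1}\to\mathfrak g_{\bar 0}$ with $s_{\mathfrak g}(\lambda x)=\lambda^2 s_{\mathfrak g}(x)$ such that $[x,y]_{\mathfrak g}:=s_{\mathfrak g}(x+y)-s_{\mathfrak g}(x)-s_{\mathfrak g}(y)$ is bilinear on $\mathfrak g_{\bar 1}$, and $[s_{\mathfrak g}(x),y]_{\mathfrak g}=[x,[x,y]_{\mathfrak g}]_{\mathfrak g}$ for $x\in\mathfrak g_{\bar 1}$, $y\in\mathfrak g$. A derivation is a linear map $D$ with $D([x,y])=[D(x),y]+[x,D(y)]$ for $x\in\mathfrak g_{\bar 0},y\in\mathfrak g$ and $D(s_{\mathfrak g}(x))=[D(x),x]$ for $x\in\mathfrak g_{\bar 1}$;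 $\mathfrak{der}(\mathfrak g)_{\bar 0}$ denotes the even ones. NIS: a non-degenerate invariant ($\mathscr B([x,y],z)=\mathscr B(x,[y,z])$) symmetric bilinear form with $\mathscr B(x,x)=0$ for odd $x$. A form is $\bar 1$-antisymmetric if it is symmetric and $\omega(x,x)=0$ for all even $x$; ortho-orthogonal means even and non-degenerate; closed means $\omega([x,y],z)+\omega([z,x],y)+\omega([y,z],x)=0$ for all $x,y,z$ and $\omega(s_{\mathfrak g}(x),z)=\omega(x,[x,z])$ for $x\in\mathfrak g_{\bar 1},z\in\mathfrak g$. $\mathscr B$ is $\Delta$-invariant if $\mathscr B(\Delta(u),v)=\mathscr B(u,\Delta(v))$ for all $u,v$ and $\mathscr B(\Delta(u),u)=0$ for all even $u$. $\mathscr D_{\bar 0}$-extension: let $\mathscr D\in\mathfrak{der}(\mathfrak a)_{\bar 0}$ with $\mathscr B_{\mathfrak a}(\mathscr D(a),b)+\mathscr B_{\mathfrak a}(a,\mathscr D(b))=0$ for all $a,b\in\mathfrak a$ and $\mathscr B_{\mathfrak a}(\mathscr D(a),a)=0$ for $a\in\mathfrak a_{\bar 0}$, and let $\alpha:\mathfrak a_{\bar 1}\to\mathbb K$ be a quadratic form whose polar form $\mathscr B_\alpha(a,b)=\alpha(a+b)+\alpha(a)+\alpha(b)$ equals $\mathscr B_{\mathfrak a}(a,\mathscr D(b))$ on $\mathfrak a_{\bar 1}$. Then $\mathfrak g=\mathbb Kx\oplus\mathfrak a\oplus\mathbb Kx^*$ with $x,x^*$ even, squaring $s_{\mathfrak g}(a)=s_{\mathfrak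 a}(a)+\alpha(a)x$ for $a\in\mathfrak g_{\bar 1}=\mathfrak a_{\bar 1}$, bracket $[x,\mathfrak g]_{\mathfrak g}=0$, $[a,b]_{\mathfrak g}=[a,b]_{\mathfrak a}+\mathscr B_{\mathfrak a}(\mathscr D(a),b)x$, $[x^*,a]_{\mathfrak g}=\mathscr D(a)$ ($a,b\in\mathfrak a$), and form $\mathscr B_{\mathfrak g}|_{\mathfrak a\times\mathfrak a}=\mathscr B_{\mathfrak a}$, $\mathscr B_{\mathfrak g}(\mathfrak a,x)=\mathscr B_{\mathfrak g}(\mathfrak a,x^* )=0$, $\mathscr B_{\mathfrak g}(x,x^* )=1$, $\mathscr B_{\mathfrak g}(x,x)=0$, $\mathscr B_{\mathfrak g}(x^*,x^* )$ arbitrary; this is an even NIS-Lie superalgebra. *)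

(* Defs.v *)
From HB Require Import structures.
From mathcomp Require Import all_boot all_order all_algebra.

Set Implicit Arguments.
Unset Strict Implicit.
Unset Printing Implicit Defensive.

Import GRing.Theory.
Local Open Scope ring_scope.

(* Raw data of a Lie superalgebra. The bracket is the total one on g; the
   squaring is only meaningful on [odd_part], its values elsewhere are unused. *)
Record superalg (K : fieldType) := Superalg {
  carrier :> vectType K;
  even_part : {vspace carrier};
  odd_part : {vspace carrier};
  br : carrier -> carrier -> carrier;
  sq : carrier -> carrier
}.

Arguments br {K s}.
Arguments sq {K s}.

(* These are the axioms in characteristic 2, which is not part of the record. *)
Record is_lie_superalg (K : fieldType) (g : superalg K) : Prop := {
  superspace_sum : (even_part g + odd_part g = fullv)%VS;
  superspace_direct : (even_part g :&: odd_part g = 0)%VS;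
  br_bilinear : bilinear_for *:%R *:%R (@br K g);
  br_even_even : forall x y, x \in even_part g -> y \in even_part g ->
    br x y \in even_part g;
  br_even_odd : forall x y, x \in even_part g -> y \in odd_part g ->
    br x y \in odd_part g;
  br_alternating : forall x, x \in even_part g -> br x x = 0;
  br_jacobi : forall x y z, x \in even_part g -> y \in even_part g -> z \in even_part g ->
    br x (br y z) + br y (br z x) + br z (br x y) = 0;
  br_module : forall x y z, x \in even_part g -> y \in even_part g -> z \in odd_part g ->
    br (br x y) z = br x (br y z) - br y (br x z);
  br_two_sided : forall x y, x \in even_part g -> y \in odd_part g -> br y x = br x y;
  sq_even : forall x, x \in odd_part g -> sq x \in even_part g;
  sq_scale : forall (l : K) x, x \in odd_part g -> sq (l *: x) = l ^+ 2 *: sq x;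
  br_polar : forall x y, x \in odd_part g -> y \in odd_part g ->
    br x y = sq (x + y) - sq x - sq y;
  br_sq : forall x y, x \in odd_part g -> br (sq x) y = br x (br x y)
}.

Definition is_derivation (K : fieldType) (g : superalg K) (D : g -> g) : Prop :=
  [/\ linear D,
      forall x y, x \in even_part g -> D (br x y) = br (D x) y + br x (D y)
    & forall x, x \in odd_part g -> D (sq x) = br (D x) x].

Definition is_even_map (K : fieldType) (g : superalg K) (D : g -> g) : Prop :=
  (forall x, x \in even_part g -> D x \in even_part g) /\
  (forall x, x \in odd_part g -> D x \in odd_part g).

Definition is_even_derivation (K : fieldType) (g : superalg K) (D : g -> g) :
  Prop := is_derivation D /\ is_even_map D.

Section Forms.
Variables (K : fieldType) (g : superalg K).
Implicit Type B : g -> g -> K.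

Definition is_bilinear_form B : Prop := bilinear_for *%R *%R B.

Definition is_symmetric_form B : Prop := forall x y, B x y = B y x.

Definition is_nondegenerate B : Prop :=
  forall x, (forall y, B x y = 0) -> x = 0.

Definition is_even_form B : Prop :=
  forall x y, x \in even_part g -> y \in odd_part g -> B x y = 0 /\ B y x = 0.

Definition is_invariant B : Prop :=
  forall x y z, B (br x y) z = B x (br y z).

Definition is_NIS B : Prop :=
  [/\ is_bilinear_form B, is_nondegenerate B, is_invariant B,
      is_symmetric_form B & forall x, x \in odd_part g -> B x x = 0].

Definition is_even_NIS_lie_superalg B : Prop :=
  [/\ is_lie_superalg g, is_NIS B & is_even_form B].

Definition is_1antisymmetric B : Prop :=
  is_symmetric_form B /\ forall x, x \in even_part g -> B x x = 0.

Definition is_ortho_orthogonal B : Prop :=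
  is_even_form B /\ is_nondegenerate B.

Definition is_closed B : Prop :=
  (forall x y z, B (br x y) z + B (br z x) y + B (br y z) x = 0) /\
  (forall x z, x \in odd_part g -> B (sq x) z = B x (br x z)).

Definition is_closed_1antisym_ortho_orthogonal B : Prop :=
  [/\ is_bilinear_form B, is_closed B, is_1antisymmetric B
    & is_ortho_orthogonal B].

Definition is_map_invariant B (Delta : g -> g) : Prop :=
  (forall u v, B (Delta u) v = B u (Delta v)) /\
  (forall u, u \in even_part g -> B (Delta u) u = 0).

End Forms.

Definition polar (K : fieldType) (V : lmodType K) (q : V -> K) (a b : V) : K :=
  q (a + b) + q a + q b.

(* Characteristic 2 convention for the polar form; as for [sq], a quadratic
   form on a subspace is a function on V whose values are only used on U. *)
Definition is_quadratic_form_on (K : fieldType) (V : vectType K)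
    (U : {vspace V}) (q : V -> K) : Prop :=
  [/\ forall (l : K) a, a \in U -> q (l *: a) = l ^+ 2 * q a,
      forall (l : K) a b c, a \in U -> b \in U -> c \in U ->
        polar q (l *: a + b) c = l * polar q a c + polar q b c
    & forall (l : K) a b c, a \in U -> b \in U -> c \in U ->
        polar q c (l *: a + b) = l * polar q c a + polar q c b].

Definition is_D0_extension_datum (K : fieldType) (a : superalg K)
    (B : a -> a -> K) (D : a -> a) (alpha : a -> K) : Prop :=
  [/\ is_even_derivation D,
      forall u v, B (D u) v + B u (D v) = 0,
      forall u, u \in even_part a -> B (D u) u = 0,
      is_quadratic_form_on (odd_part a) alpha
    & forall u v, u \in odd_part a -> v \in odd_part a -> polar alpha u v = B u (D v)].

Section D0Extension.
Variables (K : fieldType) (a : superalg K).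

(* K x + a + K xs, where xs is the dual vector written x^* on paper; the
   triple (p, u, q) stands for p x + u + q xs. *)
Definition ext_space : vectType K := (K^o * carrier a * K^o)%type.

Definition ext_mk (p : K) (u : a) (q : K) : ext_space :=
  ((p : K^o, u), q : K^o).
Definition coef_x (w : ext_space) : K := w.1.1.
Definition part_a (w : ext_space) : a := w.1.2.
Definition coef_xs (w : ext_space) : K := w.2.

Definition ext_x : ext_space := ext_mk 1 0 0.
Definition ext_xs : ext_space := ext_mk 0 0 1.
Definition ext_incl (u : a) : ext_space := ext_mk 0 u 0.

Lemma ext_incl_is_linear : linear ext_incl.
Proof.
by move=> l u v; congr (_, _, _); rewrite /= scaler0 addr0.
Qed.

HB.instance Definition _ :=
  GRing.isLinear.Build K a ext_space *:%R ext_incl ext_incl_is_linear.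

Variables (B : a -> a -> K) (D : a -> a) (alpha : a -> K).

(* Bilinear extension of [x, -] = 0, [u, v] = [u, v]_a + B(D u, v) x and
   [xs, u] = [u, xs] = D u, with [xs, xs] = 0 since xs is even. *)
Definition ext_br (w w' : ext_space) : ext_space :=
  ext_mk (B (D (part_a w)) (part_a w'))
         (br (part_a w) (part_a w')
            + coef_xs w *: D (part_a w') + coef_xs w' *: D (part_a w))
         0.

Definition ext_sq (w : ext_space) : ext_space :=
  ext_mk (alpha (part_a w)) (sq (part_a w)) 0.

Definition D0_extension : superalg K := {|
  carrier := ext_space;
  even_part := (<[ext_x]> + linfun ext_incl @: even_part a + <[ext_xs]>)%VS;
  odd_part := (linfun ext_incl @: odd_part a)%VS;
  br := ext_br;
  sq := ext_sq
|}.

(* [c] is the arbitrary value of the form on (xs, xs). *)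
Definition D0_form (c : K) (w w' : D0_extension) : K :=
  B (part_a w) (part_a w')
    + coef_x w * coef_xs w' + coef_xs w * coef_x w'
    + c * (coef_xs w * coef_xs w').

(* Linear extension of x |-> l x, xs |-> l xs + a0,
   u |-> Dt u + B(u, a0) x. *)
Definition ext_Delta (Dt : a -> a) (l : K) (a0 : a) (w : D0_extension) :
    D0_extension :=
  coef_x w *: (l *: ext_x)
    + (ext_incl (Dt (part_a w)) + B (part_a w) a0 *: ext_x)
    + coef_xs w *: (l *: ext_xs + ext_incl a0).

End D0Extension.

(* Main.v *)
Require Import Defs.
From mathcomp Require Import all_boot all_order all_algebra.
Import GRing.Theory.
Local Open Scope ring_scope.

(** In characteristic 2 signs disappear, and the axioms that a Lie superalgebra
    imposes on homogeneous elements combine into identities valid everywhere: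
    the bracket is symmetric ([br_sym]), [ad x] is a derivation of the bracket
    ([br_leibniz]), and a derivation satisfies the Leibniz rule everywhere
    ([derivation_br]).  The odd cases come from polarizing the squaring.  With
    these identities the claims about [K x + a + K x^*] become computations in
    the coordinates [(p, u, q)] of [p x + u + q x^*], almost free of parity cases.

    The double extension is a Lie superalgebra because [(u, v) |-> Ba (D u) v] is
    a 2-cocycle on [a] (invariance of [Ba] and skewness of [D]) on which [D] acts
    trivially; on the odd part this cocycle is the polar form of [alpha], so the
    squaring lifts as well.

    That [Delta] is a derivation is checked coordinate by coordinate.  On the
    bracket of [x^*] with [u] in [a] it is exactly the commutator hypothesis on
    [Dt] and [D].  On two vectors of [a] the [x]-component is the same hypothesis
    paired with the second vector, after [Dt] (self-adjoint because [omega] is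
    symmetric) has been moved across [Ba]; on squares it is the condition
    relating [alpha] and [a0].  In the ordered decomposition [x^*, a, x] the map
    [Delta] is triangular with diagonal [l, Dt, l], hence bijective.

    Finally, on any even NIS superalgebra an even injective derivation
    that leaves the form [B] invariant yields a closed form [B (Delta u) v]
    ([closed_form_of_derivation]), which is applied to the extension. *)

(** * Characteristic 2 arithmetic *)

Section Char2.
Context {K : fieldType} (charK : 2%N \in [pchar K]).

Lemma addvv_char2 (V : lmodType K) (v : V) : v + v = 0.
Proof. by rewrite -mulr2n -scaler_nat (pcharf0 charK) scale0r. Qed.

Lemma oppv_char2 (V : lmodType K) (v : V) : - v = v.
Proof. by apply/esym/eqP; rewrite -addr_eq0 addvv_char2. Qed.

Lemma addKv_char2 (V : lmodType K) (u v : V) : u + (u + v) = v.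
Proof. by rewrite addrA addvv_char2 add0r. Qed.

Lemma subv_char2 (V : lmodType K) (u v : V) : u - v = u + v.
Proof. by rewrite oppv_char2. Qed.

Lemma addkk_char2 (k : K) : k + k = 0.
Proof. exact: (@addvv_char2 K^o). Qed.

Lemma addKk_char2 (k m : K) : k + (k + m) = m.
Proof. exact: (@addKv_char2 K^o). Qed.

Lemma eq_of_add_char2 (V : lmodType K) (u v : V) : u + v = 0 -> u = v.
Proof. by move/eqP; rewrite addr_eq0 oppv_char2 => /eqP. Qed.

Lemma eqk_of_add_char2 (u v : K) : u + v = 0 -> u = v.
Proof. exact: (@eq_of_add_char2 K^o). Qed.

End Char2.

(** Proves an equality of sums in which every summand occurs an even number of
    times overall.  The scalar lemmas are tried separately because unification
    does not see [K] as the module [K^o]. *)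
Ltac char2 charK :=
  first [ apply: (eqk_of_add_char2 charK) | apply: (eq_of_add_char2 charK) ];
  rewrite -?addrA ?addr0 ?add0r;
  (* Cancel the leading summand, or else bring its next occurrence one step
     closer to the front. *)
  repeat first
    [ rewrite (addKv_char2 charK) | rewrite (addKk_char2 charK)
    | rewrite (addvv_char2 charK) | rewrite (addkk_char2 charK)
    | lazymatch goal with |- ?t + _ = _ =>
        first [ rewrite (addrCA _ t) | rewrite (addrC _ t) ]
      end ];
  reflexivity.

(** * Parity-free identities in a Lie superalgebra of characteristic 2 *)

Section LieSuperalgebra.
Context {K : fieldType} (charK : 2%N \in [pchar K]).
Context {g : superalg K} (hg : is_lie_superalg g).

Lemma brDl (x y z : g) : br (x + y) z = br x z + br y z.
Proof. by have := (br_bilinear hg).1 z 1 x y; rewrite /= !scale1r. Qed.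

Lemma brDr (x y z : g) : br z (x + y) = br z x + br z y.
Proof. by have := (br_bilinear hg).2 z 1 x y; rewrite /= !scale1r. Qed.

Lemma br0l (z : g) : br 0 z = 0.
Proof. by apply: (addrI (br 0 z)); rewrite -brDl !addr0. Qed.

Lemma br0r (z : g) : br z 0 = 0.
Proof. by apply: (addrI (br z 0)); rewrite -brDr !addr0. Qed.

Lemma brZl (k : K) (x z : g) : br (k *: x) z = k *: br x z.
Proof.
by have := (br_bilinear hg).1 z k x 0; rewrite /= !addr0 br0l addr0.
Qed.

Lemma brZr (k : K) (x z : g) : br z (k *: x) = k *: br z x.
Proof.
by have := (br_bilinear hg).2 z k x 0; rewrite /= !addr0 br0r addr0.
Qed.

Lemma superspace_ind (P : g -> Prop) :
    (forall x y, P x -> P y -> P (x + y)) ->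
    (forall x, x \in even_part g -> P x) ->
    (forall x, x \in odd_part g -> P x) ->
  forall x, P x.
Proof.
move=> PD P0 P1 x; have: x \in (even_part g + odd_part g)%VS.
  by rewrite (superspace_sum hg) memvf.
by case/memv_addP=> u /P0 Pu [v /P1 Pv ->]; apply: PD.
Qed.

Lemma br_polar_char2 (x y : g) : x \in odd_part g -> y \in odd_part g ->
  br x y = sq (x + y) + sq x + sq y.
Proof. by move=> hx hy; rewrite (br_polar hg hx hy) !(subv_char2 charK). Qed.

Lemma sqD (x y : g) : x \in odd_part g -> y \in odd_part g ->
  sq (x + y) = br x y + sq x + sq y.
Proof. by move=> hx hy; rewrite br_polar_char2 //; char2 charK. Qed.

Lemma br_sym (x y : g) : br x y = br y x.
Proof.
move: x; apply: superspace_ind => [x x' ex ex'|x hx|x hx].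
- by rewrite brDl brDr ex ex'.
- move: y; apply: superspace_ind => [y y' ey ey'|y hy|y hy].
  + by rewrite brDl brDr ey ey'.
  + have := br_alternating hg (memvD hx hy).
    rewrite brDl !brDr (br_alternating hg hx) (br_alternating hg hy) add0r addr0.
    exact: (eq_of_add_char2 charK).
  + by rewrite (br_two_sided hg hx hy).
move: y; apply: superspace_ind => [y y' ey ey'|y hy|y hy].
- by rewrite brDl brDr ey ey'.
- by rewrite (br_two_sided hg hy hx).
by rewrite !br_polar_char2 // (addrC y) addrAC.
Qed.

(** For two odd arguments this is [[sq x, z] = [x, [x, z]]] polarized in [x]; the
    even-odd case evaluated at an odd vector is the same polarization with the
    entries permuted. *)
Lemma br_leibniz (x y z : g) : br (br x y) z = br x (br y z) + br y (br x z).
Proof.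
have oo (u v w : g) : u \in odd_part g -> v \in odd_part g ->
    br (br u v) w = br u (br v w) + br v (br u w).
  move=> hu hv; have := br_sq hg w (memvD hu hv).
  rewrite sqD // !brDl !brDr (br_sq hg w hu) (br_sq hg w hv) => e.
  apply: (addIr (br u (br u w) + br v (br v w))); rewrite addrA e.
  by char2 charK.
have eo (u v w : g) : u \in even_part g -> v \in odd_part g ->
    br (br u v) w = br u (br v w) + br v (br u w).
  move=> hu hv; move: w; apply: superspace_ind => [w w' ew ew'|w hw|w hw].
  - by rewrite !brDr ew ew' addrACA.
  - have := br_module hg hu hw hv; rewrite (subv_char2 charK) => e.
    by rewrite (br_sym v (br u w)) (br_sym v w) e (br_sym _ w); char2 charK.
  have := oo v w u hv hw; rewrite (br_sym _ u) => ->.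
  by rewrite (br_sym _ w) (br_sym w u) (br_sym v u); char2 charK.
move: x; apply: superspace_ind => [x x' ex ex'|x hx|x hx].
- by rewrite !brDl ex ex' brDr addrACA.
- move: y; apply: superspace_ind => [y y' ey ey'|y hy|y hy].
  + by rewrite !(brDl, brDr) ey ey' addrACA.
  + move: z; apply: superspace_ind => [z z' ez ez'|z hz|z hz].
    * by rewrite !brDr ez ez' addrACA.
    * apply: (eq_of_add_char2 charK); rewrite -[RHS](br_jacobi hg hx hy hz).
      by rewrite (br_sym z x) (br_sym z (br x y)); char2 charK.
    by rewrite (br_module hg hx hy hz) (subv_char2 charK).
  exact: eo.
move: y; apply: superspace_ind => [y y' ey ey'|y hy|y hy].
- by rewrite !(brDl, brDr) ey ey' addrACA.
- by rewrite (br_sym x y) (eo _ _ _ hy hx) addrC.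
exact: oo.
Qed.

Lemma derivationD {D : g -> g} : is_derivation D -> {morph D : x y / x + y}.
Proof. by case=> linD _ _ x y; have := linD 1 x y; rewrite !scale1r. Qed.

Lemma derivationZ {D : g -> g} (k : K) (x : g) :
  is_derivation D -> D (k *: x) = k *: D x.
Proof.
move=> hD; have D0 : D 0 = 0.
  by apply: (addrI (D 0)); rewrite -(derivationD hD) !addr0.
by case: hD => linD _ _; have := linD k x 0; rewrite !addr0 D0 addr0.
Qed.

(** On two odd vectors the rule is the polarization of [D (sq x) = [D x, x]]. *)
Lemma derivation_br {D : g -> g} : is_even_derivation D ->
  forall x y, D (br x y) = br (D x) y + br x (D y).
Proof.
case=> hD [_ Dodd] x y; have DD := derivationD hD; case: (hD) => _ Dev Dsq.
move: x; apply: superspace_ind => [x x' ex ex'|x hx|x hx].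
- by rewrite !(brDl, DD) ex ex' addrACA.
- exact: Dev.
move: y; apply: superspace_ind => [y y' ey ey'|y hy|y hy].
- by rewrite !(brDr, DD) ey ey' addrACA.
- by rewrite br_sym Dev // addrC (br_sym y) (br_sym x).
rewrite br_polar_char2 // !DD !Dsq ?memvD // DD !(brDl, brDr) (br_sym x).
by char2 charK.
Qed.

End LieSuperalgebra.

(** * Bilinear forms and the closed form of an invertible derivation *)

Section BilinearForm.
Context {K : fieldType} {g : superalg K} {B : g -> g -> K}.
Context (hB : is_bilinear_form B).

Lemma formDl x y z : B (x + y) z = B x z + B y z.
Proof. by have := hB.1 z 1 x y; rewrite /= scale1r mul1r. Qed.

Lemma formDr x y z : B z (x + y) = B z x + B z y.
Proof. by have := hB.2 z 1 x y; rewrite /= scale1r mul1r. Qed.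

Lemma form0l z : B 0 z = 0.
Proof. by apply: (addrI (B 0 z)); rewrite -formDl !addr0. Qed.

Lemma form0r z : B z 0 = 0.
Proof. by apply: (addrI (B z 0)); rewrite -formDr !addr0. Qed.

Lemma formZl k x z : B (k *: x) z = k * B x z.
Proof. by have := hB.1 z k x 0; rewrite /= !addr0 form0l addr0. Qed.

Lemma formZr k x z : B z (k *: x) = k * B z x.
Proof. by have := hB.2 z k x 0; rewrite /= !addr0 form0r addr0. Qed.

End BilinearForm.

(** The Leibniz rule turns [B (Delta [x, y]) z] into
    [B (Delta x) [y, z] + B (Delta y) [z, x]]; self-adjointness turns the two
    other terms of the cyclic sum into the same two scalars, which cancel. *)
Lemma closed_form_of_derivation {K : fieldType} (charK : 2%N \in [pchar K])
    {g : superalg K} {B : g -> g -> K} {Delta : g -> g} :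
    is_even_NIS_lie_superalg B -> is_even_derivation Delta ->
    injective Delta -> is_map_invariant B Delta ->
  is_closed_1antisym_ortho_orthogonal (fun u v => B (Delta u) v).
Proof.
case=> hg [bilB ndB invB symB _] evB hDelta injD [selfD altD].
have [hder [Dev Dodd]] := hDelta; have leib := derivation_br charK hg hDelta.
have DD := derivationD hder; have DZ k x := derivationZ k x hder.
split.
- split=> [z k x y|z k x y] /=.
  + by rewrite DD DZ (formDl bilB) (formZl bilB).
  + by rewrite (formDr bilB) (formZr bilB).
- split=> [x y z|x z hx]; last by case: hder => _ _ ->; rewrite // invB.
  rewrite leib (formDl bilB) (br_sym charK hg x (Delta y)) !invB.
  rewrite (selfD (br z x)) (selfD (br y z)) (symB (br z x)) (symB (br y z)).
  by rewrite (br_sym charK hg x z); char2 charK.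
- by split=> [u v|u hu]; rewrite ?altD // selfD symB.
split=> [u v hu hv|u hu].
  split; first by case: (evB _ _ (Dev _ hu) hv).
  by case: (evB _ _ hu (Dodd _ hv)).
have Du0 := ndB _ hu; apply: injD; rewrite Du0.
by apply: (addrI (Delta 0)); rewrite -DD !addr0.
Qed.

(** * The double extension by a derivation *)

Section DoubleExtension.
Context {K : fieldType} (charK : 2%N \in [pchar K]).
Context {a : superalg K} {Ba : a -> a -> K} {D : a -> a} {alpha : a -> K}.
Context (ha : is_even_NIS_lie_superalg Ba).
Context (hD : is_D0_extension_datum Ba D alpha).

Let lie_a : is_lie_superalg a := let: And3 h _ _ := ha in h.
Let bil : is_bilinear_form Ba := let: And3 _ (And5 h _ _ _ _) _ := ha in h.
Let inv : is_invariant Ba := let: And3 _ (And5 _ _ h _ _) _ := ha in h.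
Let sym : is_symmetric_form Ba := let: And3 _ (And5 _ _ _ h _) _ := ha in h.
Let der : is_even_derivation D := let: And5 h _ _ _ _ := hD in h.

Local Notation g := (D0_extension Ba D alpha).

(** The vector [p x + u + q x^*], typed in the superalgebra itself so that sums,
    brackets and squares of such vectors can be rewritten in coordinates.  It is
    locked because unification would otherwise see every vector of the extension
    as one given by coordinates. *)
Definition ext_vec (p : K) (u : a) (q : K) : g := locked (ext_mk p u q).
Local Notation vec := ext_vec.

Lemma ext_vecE p u q : vec p u q = ext_mk p u q.
Proof. by rewrite /ext_vec -lock. Qed.

Lemma ext_ind (P : g -> Prop) : (forall p u q, P (vec p u q)) -> forall w, P w.
Proof. by move=> h [[p u] q]; have := h p u q; rewrite ext_vecE. Qed.

Lemma vec_eq {p p' q q' : K} {u u' : a} :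
  p = p' -> u = u' -> q = q' -> vec p u q = vec p' u' q'.
Proof. by move=> -> -> ->. Qed.

Lemma vecD p u q p' u' q' :
  vec p u q + vec p' u' q' = vec (p + p') (u + u') (q + q').
Proof. by rewrite !ext_vecE. Qed.

Lemma vecZ k p u q : k *: vec p u q = vec (k * p) (k *: u) (k * q).
Proof. by rewrite !ext_vecE. Qed.

Lemma vec0 : 0 = vec 0 0 0.
Proof. by rewrite ext_vecE. Qed.

Lemma br_vec p u q p' u' q' : br (vec p u q) (vec p' u' q') =
  vec (Ba (D u) u') (br u u' + q *: D u' + q' *: D u) 0.
Proof. by rewrite !ext_vecE. Qed.

Lemma sq_vec p u q : sq (vec p u q) = vec (alpha u) (sq u) 0.
Proof. by rewrite !ext_vecE. Qed.

Lemma part_a_vec p u q : part_a (vec p u q) = u.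
Proof. by rewrite ext_vecE. Qed.

Lemma coef_x_vec p u q : coef_x (vec p u q) = p.
Proof. by rewrite ext_vecE. Qed.

Lemma coef_xs_vec p u q : coef_xs (vec p u q) = q.
Proof. by rewrite ext_vecE. Qed.

Lemma ext_x_vec : ext_x a = vec 1 0 0.
Proof. by rewrite ext_vecE. Qed.

Lemma ext_xs_vec : ext_xs a = vec 0 0 1.
Proof. by rewrite ext_vecE. Qed.

Lemma ext_incl_vec u : ext_incl u = vec 0 u 0.
Proof. by rewrite ext_vecE. Qed.

Lemma vec_even p u q : (vec p u q \in even_part g) = (u \in even_part a).
Proof.
apply/idP/idP => [|hu].
  case/memv_addP=> _ /memv_addP[_ /vlineP[r ->] [_ /memv_imgP[v hv ->] ->]].
  case=> _ /vlineP[t ->]; rewrite lfunE /= ext_vecE => e.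
  suff -> : u = v by [].
  have := congr1 (@part_a K a) e; rewrite /part_a /= => ->.
  by rewrite !scaler0 add0r addr0.
have -> : vec p u q =
    p *: ext_x a + linfun (ext_incl (a:=a)) u + q *: ext_xs a.
  rewrite lfunE ext_vecE -[RHS]/(ext_mk (p * 1 + 0 + q * 0)
    (p *: 0 + u + q *: 0) (p * 0 + 0 + q * 1)).
  by rewrite !(scaler0, mulr0, mulr1, addr0, add0r).
by rewrite !memv_add ?memvZ ?memv_line ?memv_img.
Qed.

Lemma vec_oddP (w : g) :
  reflect (exists2 u, u \in odd_part a & w = vec 0 u 0) (w \in odd_part g).
Proof.
apply: (iffP memv_imgP) => -[u hu ->]; exists u => //;
  by rewrite lfunE /= ext_incl_vec.
Qed.

Let bDl := formDl bil.
Let bDr := formDr bil.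
Let bZl := formZl bil.
Let bZr := formZr bil.
Let DD := derivationD der.1.
Let DZ k x := derivationZ (D := D) k x der.1.
Let leib := derivation_br charK lie_a der.
Let aDl := brDl lie_a.
Let aDr := brDr lie_a.
Let aZl := brZl lie_a.
Let aZr := brZr lie_a.
Let asym := br_sym charK lie_a.

Lemma D_skew u v : Ba (D u) v = Ba u (D v).
Proof. by apply: (eqk_of_add_char2 charK); case: hD => _ ->. Qed.

Lemma D_alt u : u \in even_part a -> Ba (D u) u = 0.
Proof. by case: hD => _ _ + _ _; apply. Qed.

Lemma sq_D u : u \in odd_part a -> D (sq u) = br (D u) u.
Proof. by case: der => -[_ _ +] _; apply. Qed.

(** In the [x]-component this is the cocycle identity for
    [(u, v) |-> Ba (D u) v]. *)
Lemma ext_leibniz (w1 w2 w3 : g) :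
  br (br w1 w2) w3 = br w1 (br w2 w3) + br w2 (br w1 w3).
Proof.
move: w1 w2 w3; apply: ext_ind => p1 u1 q1; apply: ext_ind => p2 u2 q2.
apply: ext_ind => p3 u3 q3; rewrite !br_vec !vecD; apply: vec_eq.
- rewrite !(DD, DZ, leib, bDl, bDr, bZl, bZr) (D_skew (D u1)) (D_skew (D u2)).
  rewrite (asym u1 (D u2)) !inv (sym (D u2) (D u1)).
  by char2 charK.
- rewrite !(DD, DZ, leib, aDl, aDr, aZl, aZr) (br_leibniz charK lie_a u1).
  rewrite (asym u2 (D u1)) !scale0r !scalerDr !scalerA.
  rewrite (mulrC q3 q1) (mulrC q3 q2) (mulrC q2 q1).
  by char2 charK.
by rewrite addr0.
Qed.

Lemma ext_br_sym (w w' : g) : br w w' = br w' w.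
Proof.
move: w w'; apply: ext_ind => p u q; apply: ext_ind => p' u' q'.
rewrite !br_vec; apply: vec_eq => //; first by rewrite D_skew sym.
by rewrite asym addrAC.
Qed.

Lemma ext_br_linearl (k : K) (w1 w2 w0 : g) :
  br (k *: w1 + w2) w0 = k *: br w1 w0 + br w2 w0.
Proof.
move: w1 w2 w0; apply: ext_ind => p1 u1 q1; apply: ext_ind => p2 u2 q2.
apply: ext_ind => p0 u0 q0; rewrite !(vecZ, vecD, br_vec); apply: vec_eq.
- by rewrite DD DZ bDl bZl.
- rewrite DD DZ aDl aZl !(scalerDl, scalerDr) !scalerA (mulrC k q0).
  by char2 charK.
by rewrite mulr0 addr0.
Qed.

Lemma ext_lie : is_lie_superalg g.
Proof.
have [_ _ _ [alphaZ _ _] alpha_polar] := hD; have [Dev Dodd] := der.2.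
split.
- apply/vspaceP=> w; rewrite memvf; move: w; apply: ext_ind => p u q.
  have : u \in (even_part a + odd_part a)%VS.
    by rewrite (superspace_sum lie_a) memvf.
  case/memv_addP=> u0 hu0 [u1 hu1 ->].
  apply/memv_addP; exists (vec p u0 q); first by rewrite vec_even.
  exists (vec 0 u1 0); first by apply/vec_oddP; exists u1.
  by rewrite vecD !addr0.
- apply/vspaceP=> w; rewrite memv_cap memv0; apply/andP/eqP.
    case=> h /vec_oddP[u hu e]; move: h; rewrite e vec_even => hu'.
    have : u \in (even_part a :&: odd_part a)%VS by rewrite memv_cap hu' hu.
    by rewrite (superspace_direct lie_a) memv0 vec0 => /eqP ->.
  by move=> ->; rewrite !mem0v.
- by split=> w0 k w1 w2; [|rewrite !(ext_br_sym w0)]; apply: ext_br_linearl.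
- apply: ext_ind => p1 u1 q1; apply: ext_ind => p2 u2 q2.
  rewrite br_vec !vec_even => h1 h2.
  by rewrite !memvD ?memvZ ?Dev ?(br_even_even lie_a).
- apply: ext_ind => p1 u1 q1 w; rewrite vec_even => h1 /vec_oddP[u hu ->].
  apply/vec_oddP; exists (br u1 u + q1 *: D u).
    by rewrite memvD ?memvZ ?Dodd ?(br_even_odd lie_a).
  (* The [x]-coefficient [Ba (D u1) u] pairs an even with an odd vector. *)
  rewrite br_vec scale0r addr0; apply: vec_eq => //.
  by case: ha => _ _ ev; case: (ev _ _ (Dev _ h1) hu).
- apply: ext_ind => p u q; rewrite vec_even => hu.
  rewrite br_vec D_alt // (br_alternating lie_a hu) vec0.
  by apply: vec_eq => //; char2 charK.
- move=> w1 w2 w3 _ _ _; rewrite (ext_br_sym w3 (br w1 w2)) ext_leibniz.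
  by rewrite (ext_br_sym w3 w1); char2 charK.
- by move=> w1 w2 w3 _ _ _; rewrite (subv_char2 charK); apply: ext_leibniz.
- by move=> w1 w2 _ _; apply: ext_br_sym.
- by move=> w /vec_oddP[u hu ->]; rewrite sq_vec vec_even (sq_even lie_a hu).
- move=> k w /vec_oddP[u hu ->]; rewrite !(vecZ, sq_vec) alphaZ // (sq_scale lie_a) //.
  by rewrite mulr0.
- move=> _ _ /vec_oddP[u hu ->] /vec_oddP[v hv ->].
  rewrite !(subv_char2 charK) br_vec vecD !sq_vec !vecD !scale0r !addr0.
  by apply: vec_eq => //; rewrite ?(br_polar_char2 charK lie_a) // D_skew -alpha_polar.
move=> w w' /vec_oddP[u hu ->]; move: w'; apply: ext_ind => p v q.
rewrite sq_vec !br_vec !scale0r !addr0 sq_D // !(bDr, bZr, aDr, aZr).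
apply: vec_eq => //; last by rewrite (br_sq lie_a) // (asym u (D u)).
case: ha => _ [_ _ _ _ altB] _.
by rewrite inv altB ?Dodd // mulr0 addr0.
Qed.

Local Notation Bg := (@D0_form K a Ba D alpha 0).

Lemma form_vec p u q p' u' q' :
  Bg (vec p u q) (vec p' u' q') = Ba u u' + p * q' + q * p'.
Proof. by rewrite /D0_form !(part_a_vec, coef_x_vec, coef_xs_vec) mul0r addr0. Qed.

Lemma form_linearl (k : K) (w1 w2 w0 : g) :
  Bg (k *: w1 + w2) w0 = k * Bg w1 w0 + Bg w2 w0.
Proof.
move: w1 w2 w0; apply: ext_ind => p1 u1 q1; apply: ext_ind => p2 u2 q2.
apply: ext_ind => p0 u0 q0; rewrite !(vecZ, vecD, form_vec) bDl bZl.
by rewrite !(mulrDl, mulrDr) !mulrA; char2 charK.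
Qed.

Lemma form_sym (w w' : g) : Bg w w' = Bg w' w.
Proof.
move: w w'; apply: ext_ind => p u q; apply: ext_ind => p' u' q'.
by rewrite !form_vec sym addrAC (mulrC q) (mulrC p).
Qed.

Lemma ext_NIS : is_even_NIS_lie_superalg Bg.
Proof.
case: ha => _ [_ nd _ _ altB] ev; split; first exact: ext_lie.
  split.
  - by split=> w0 k w1 w2; [|rewrite !(form_sym w0)]; apply: form_linearl.
  (* Pair with [x^*], with [x] and with [a] to isolate each coordinate. *)
  - apply: ext_ind => p u q h.
    have := h (vec 0 0 1); have := h (vec 1 0 0).
    rewrite !form_vec !(form0r bil) !(mulr0, mulr1, add0r, addr0) => q0 p0.
    rewrite vec0; apply: vec_eq; [exact: p0 | | exact: q0].
    by apply: nd => v; have := h (vec 0 v 0); rewrite form_vec !(mulr0, addr0).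
  - apply: ext_ind => p1 u1 q1; apply: ext_ind => p2 u2 q2.
    apply: ext_ind => p3 u3 q3.
    rewrite !(br_vec, form_vec, bDl, bDr, bZl, bZr) inv !D_skew.
    by rewrite !(mul0r, mulr0) (mulrC q3); char2 charK.
  - exact: form_sym.
  by move=> _ /vec_oddP[u hu ->]; rewrite form_vec altB // !(mul0r, addr0).
apply: ext_ind => p u q _ + /vec_oddP[v hv ->]; rewrite vec_even => hu.
have [e1 e2] := ev _ _ hu hv.
by rewrite !form_vec e1 e2 !(mul0r, mulr0, addr0).
Qed.

(** * The extended derivation *)

Section Delta.
Context {Dt : a -> a} {l : K} {a0 : a}.
Context (hDt : is_even_derivation Dt).
Context (Dt_inv : is_map_invariant Ba Dt).
Context (ha0 : a0 \in even_part a).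
Context (hcomm : forall u : a, Dt (D u) - D (Dt u) = l *: D u + br a0 u).
Context (halpha : forall u : a, u \in odd_part a ->
  l * alpha u + Ba (D (Dt u)) u = Ba (sq u) a0).

Local Notation Delta := (@ext_Delta K a Ba D alpha Dt l a0).

Let tD := derivationD hDt.1.
Let tZ k x := derivationZ (D := Dt) k x hDt.1.
Let tleib := derivation_br charK lie_a hDt.

Lemma Delta_vec p u q :
  Delta (vec p u q) = vec (l * p + Ba u a0) (Dt u + q *: a0) (l * q).
Proof.
rewrite /ext_Delta /= ext_x_vec ext_xs_vec !ext_incl_vec !(vecZ, vecD).
rewrite !(part_a_vec, coef_x_vec, coef_xs_vec).
by apply: vec_eq; rewrite !(scaler0, mulr0, mulr1, addr0, add0r) // mulrC.
Qed.

Lemma Delta_even_derivation : is_even_derivation Delta.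
Proof.
have [DtEv DtOdd] := hDt.2.
have DtDE u : Dt (D u) = D (Dt u) + (l *: D u + br a0 u).
  by rewrite -hcomm addrCA subrr addr0.
split; last first.
  split; first by apply: ext_ind => p u q; rewrite Delta_vec !vec_even => hu;
    rewrite memvD ?memvZ ?DtEv.
  move=> _ /vec_oddP[u hu ->]; apply/vec_oddP; exists (Dt u); first exact: DtOdd.
  rewrite Delta_vec !mulr0 scale0r addr0 add0r; apply: vec_eq => //.
  by case: ha => _ _ ev; case: (ev _ _ ha0 hu).
split.
- move=> k; do 2!apply: ext_ind => ? ? ?.
  rewrite !(vecZ, vecD, Delta_vec, tD, tZ, bDl, bZl); apply: vec_eq.
  + by rewrite !mulrDr !(mulrCA k l); char2 charK.
  + by rewrite scalerDl scalerDr scalerA; char2 charK.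
  by rewrite mulrDr mulrCA.
- apply: ext_ind => p1 u1 q1; apply: ext_ind => p2 u2 q2 _.
  rewrite !Delta_vec !br_vec !Delta_vec !vecD !(scale0r, mulr0, addr0); apply: vec_eq.
  + rewrite !(DD, DZ, bDl, bDr, bZl, bZr).
    (* Moving [Dt] across [Ba] turns [Ba (D u1) (Dt u2)] into [Ba (Dt (D u1)) u2],
       which meets [Ba (D (Dt u1)) u2] in the commutator. *)
    rewrite -(Dt_inv.1 (D u1)) DtDE !(bDl, bZl) inv (asym a0 u1) inv.
    by rewrite (asym u2) (D_skew a0) (sym a0 (D u2)); char2 charK.
  + rewrite !(tD, tZ, tleib, DD, DZ, aDl, aDr, aZl, aZr) !DtDE.
    rewrite !(scalerDl, scalerDr) !scalerA.
    by rewrite (asym u1 a0) !(mulrC q1) (mulrC q2 l); char2 charK.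
  by [].
move=> _ /vec_oddP[u hu ->].
rewrite !sq_vec !Delta_vec !br_vec !(scale0r, mulr0, addr0); apply: vec_eq => //.
- by rewrite -halpha // addrA (addkk_char2 charK) add0r.
by case: hDt => -[_ _ ->].
Qed.

Lemma Delta_bijective : l != 0 -> bijective Dt -> bijective Delta.
Proof.
move=> l0 [Dti DtK DtiK].
pose inv_u (w : g) := Dti (part_a w - (l^-1 * coef_xs w) *: a0).
exists (fun w : g => vec (l^-1 * (coef_x w - Ba (inv_u w) a0)) (inv_u w)
                         (l^-1 * coef_xs w)).
  apply: ext_ind => p u q; rewrite Delta_vec /inv_u.
  rewrite !(part_a_vec, coef_x_vec, coef_xs_vec).
  by rewrite !(mulKf l0) addrK DtK addrK mulKf.
apply: ext_ind => p u q; rewrite Delta_vec /inv_u.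
rewrite !(part_a_vec, coef_x_vec, coef_xs_vec).
by rewrite !(mulVKf l0) DtiK !subrK.
Qed.

Lemma Delta_invariant : is_map_invariant Bg Delta.
Proof.
split; last first.
  apply: ext_ind => p u q; rewrite vec_even => hu.
  rewrite Delta_vec form_vec bDl bZl Dt_inv.2 // (sym a0 u) mulrDl.
  by rewrite (mulrC q) (mulrAC l q p); char2 charK.
apply: ext_ind => p1 u1 q1; apply: ext_ind => p2 u2 q2.
rewrite !Delta_vec !form_vec !(bDl, bDr, bZl, bZr) Dt_inv.1 (sym a0 u2).
rewrite !(mulrDl, mulrDr).
by rewrite (mulrCA p1) (mulrCA q1 l) -!mulrA (mulrC (Ba u1 a0)); char2 charK.
Qed.

End Delta.
End DoubleExtension.

Theorem theorem4p1p5 (K : fieldType) (charK : 2%N \in [pchar K])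
    (a : superalg K) (Ba omega : a -> a -> K) (Dt D : a -> a)
    (alpha : a -> K) (l : K) (a0 : a)
    (ha : is_even_NIS_lie_superalg Ba)
    (homega : is_closed_1antisym_ortho_orthogonal omega)
    (hDt : is_even_derivation Dt) (hDt_inv : bijective Dt)
    (hDt_omega : forall u v : a, omega u v = Ba (Dt u) v)
    (hD : is_D0_extension_datum Ba D alpha)
    (hl : l != 0) (ha0 : a0 \in even_part a)
    (hcomm : forall u : a, Dt (D u) - D (Dt u) = l *: D u + br a0 u)
    (halpha : forall u : a, u \in odd_part a ->
       l * alpha u + Ba (D (Dt u)) u = Ba (sq u) a0) :
  let g : superalg K := D0_extension Ba D alpha in
  let Bg : g -> g -> K := @D0_form K a Ba D alpha 0 in
  let Delta : g -> g := @ext_Delta K a Ba D alpha Dt l a0 in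
  let omegag : g -> g -> K := fun u v => Bg (Delta u) v in
  [/\ is_derivation Delta, bijective Delta & is_map_invariant Bg Delta] /\
  (is_even_NIS_lie_superalg Bg /\ is_closed_1antisym_ortho_orthogonal omegag).
Proof.
move=> g Bg Delta omegag.
have Dt_inv : is_map_invariant Ba Dt.
  case: ha homega => _ [_ _ _ sym _] _ [_ _ [symO altO] _].
  split=> [u v|u hu]; rewrite -hDt_omega; last exact: altO.
  by rewrite symO hDt_omega sym.
have hDelta : is_even_derivation Delta by exact: Delta_even_derivation.
have bijD : bijective Delta by exact: Delta_bijective.
have invD : is_map_invariant Bg Delta by exact: Delta_invariant.
have nis : is_even_NIS_lie_superalg Bg by exact: ext_NIS.
split; first by split=> //; case: hDelta.
by split=> //; apply: closed_form_of_derivation => //; apply: bij_inj.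
Qed.
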